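(* Let $K$ be a field of characteristic zero, $n\ge 1$, and let $H=(H_1,\dots,H_n)\in K[[z]]^{n}$ with $o(H)\ge 2$, where $z=(z_1,\dots,z_n)$. Put $F(z)=z-H(z)$ and let $G(z)=z+N(z)$, with $N\in K[[z]]^{n}$ and $o(N)\ge 2$, be the formal inverse of $F$. Then for every $q(z)\in K[[z]]$, $$\Phi\left(q(z)\,(\mathcal{J}F)(z)\,e^{\langle \xi, H(z)\rangle}\right)=q(G(z))\,e^{\langle \xi, N(z)\rangle}$$ as elements of $\overline{K[\xi,z]}$.
   Context: $\xi=(\xi_1,\dots,\xi_n)$ and $z=(z_1,\dots,z_n)$ are $2n$ commuting free variables, and $\langle \xi,h\rangle=\sum_{i=1}^n\xi_i h_i$. For a tuple $h=(h_1,\dots,h_n)$ of power series in $z$, $o(h)$ is the minimum of the orders (lowest degrees in $z$ of nonzero terms) of the $h_i$. $\mathcal{J}F=\det(\partial F_i/\partial z_j)$ is the Jacobian determinant. The formal inverse $G$ is the unique tuple of power series with $F(G(z))=z=G(F(z))$; it automatically has the form $z+N$ with $o(N)\ge2$. Grading and completion: for $m\in\mathbb{Z}$ let $A_m[\xi,z]$ be the $K$-span of the monomials $\xi^\alpha z^\beta$ ($\alpha,\beta\in\mathbb{N}^n$) with $|\beta|-|\alpha|=m$. This is a $\mathbb{Z}$-grading of the polynomial algebra $K[\xi,z]$. Its completion $\overline{K[\xi,z]}$ is the algebra of formal sums $\sum_{m\in\mathbb{Z}}u_m$ with $u_m\in A_m[\xi,z]$ and $u_m=0$ for all sufficiently negative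 $m$; it is a subalgebra of $K[[\xi,z]]$. Both $q(z)(\mathcal{J}F)(z)e^{\langle\xi,H(z)\rangle}$ and $q(G)e^{\langle \xi,N(z)\rangle}$ lie in it, because $o(H),o(N)\ge2$. Let $\Lambda=\sum_{i=1}^n\partial_{\xi_i}\partial_{z_i}$. It is locally nilpotent on $K[\xi,z]$ and maps each $A_m[\xi,z]$ into itself, so $\Phi=e^{\Lambda}=\sum_{m\ge0}\Lambda^m/m!$ is a well-defined grading-preserving linear automorphism of $K[\xi,z]$. It is extended to $\overline{K[\xi,z]}$ by $\Phi(\sum_m u_m)=\sum_m\Phi(u_m)$. *)

(* Defs.v *)
From HB Require Import structures.
From mathcomp Require Import all_boot all_order all_algebra.
From mathcomp Require Import boolp.
From mathcomp Require Import mpoly.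

Set Implicit Arguments.
Unset Strict Implicit.
Unset Printing Implicit Defensive.

Import GRing.Theory.
Local Open Scope ring_scope.

(* Formal power series in n commuting variables: arbitrary families of        *)
(* coefficients indexed by the monomials 'X_{1..n} of the mpoly library.      *)
Record fps (n : nat) (R : comNzRingType) := FPS { fcoef : 'X_{1..n} -> R }.

Section FpsRing.

Variables (n : nat) (R : comNzRingType).
Implicit Types (s t u : fps n R) (m : 'X_{1..n}).

Lemma fpsP s t : fcoef s =1 fcoef t -> s = t.
Proof. by case: s t => [s] [t] /= /funext ->. Qed.

HB.instance Definition _ := gen_eqMixin (fps n R).
HB.instance Definition _ := gen_choiceMixin (fps n R).

Definition fps0 : fps n R := FPS (fun=> 0).
Definition fps_opp s := FPS (fun m => - fcoef s m).
Definition fps_add s t := FPS (fun m => fcoef s m + fcoef t m).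

Lemma fps_addA : associative fps_add.
Proof. by move=> s t u; apply: fpsP => m /=; rewrite addrA. Qed.
Lemma fps_addC : commutative fps_add.
Proof. by move=> s t; apply: fpsP => m /=; rewrite addrC. Qed.
Lemma fps_add0 : left_id fps0 fps_add.
Proof. by move=> s; apply: fpsP => m /=; rewrite add0r. Qed.
Lemma fps_addN : left_inverse fps0 fps_opp fps_add.
Proof. by move=> s; apply: fpsP => m /=; rewrite addNr. Qed.

HB.instance Definition _ :=
  GRing.isZmodule.Build (fps n R) fps_addA fps_addC fps_add0 fps_addN.

Definition fpsC (c : R) : fps n R := FPS (fun m => c *+ (m == 0%MM)).

(* The Cauchy product; the bound mdeg m only makes the index type finite.     *)
Definition fps_mul s t : fps n R :=
  FPS (fun m =>
    \sum_(k : 'X_{1..n < (mdeg m).+1, (mdeg m).+1} | m == (k.1 + k.2)%MM)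
       fcoef s k.1 * fcoef t k.2).

Definition fps_trunc (d : nat) s : {mpoly R[n]} :=
  \sum_(m : 'X_{1..n < d}) fcoef s m *: 'X_[m].

Lemma mcoeff_fps_trunc d s m : (mdeg m < d)%N -> (fps_trunc d s)@_m = fcoef s m.
Proof.
move=> lt_md; have -> : m = BMultinom lt_md by [].
by rewrite /fps_trunc (mcoeff_mpoly (fcoef s)).
Qed.

Lemma fps_mul_trunc d s t m : (mdeg m < d)%N ->
  fcoef (fps_mul s t) m = (fps_trunc d s * fps_trunc d t)@_m.
Proof.
move=> lt_md; rewrite (mcoeff_poly_mul _ _ (ltnSn (mdeg m))) /=.
apply: eq_bigr => -[k1 k2] /= _.
by rewrite !mcoeff_fps_trunc // (leq_trans (bmdeg _)).
Qed.

Lemma fps_trunc_mul d s t m : (mdeg m < d)%N ->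
  (fps_trunc d (fps_mul s t))@_m = (fps_trunc d s * fps_trunc d t)@_m.
Proof. by move=> h; rewrite mcoeff_fps_trunc // (fps_mul_trunc _ _ h). Qed.

Lemma fps_mulA : associative fps_mul.
Proof.
move=> s t u; apply: fpsP => m; have h := ltnSn (mdeg m).
rewrite !(fps_mul_trunc _ _ h).
transitivity (fps_trunc (mdeg m).+1 s * fps_trunc (mdeg m).+1 t
              * fps_trunc (mdeg m).+1 u)@_m.
  rewrite -mulrA !(mcoeff_poly_mul _ _ h); apply: eq_bigr => -[k1 k2] /= _.
  by rewrite fps_trunc_mul ?bmdeg.
rewrite !(mcoeff_poly_mul _ _ h); apply: eq_bigr => -[k1 k2] /= _.
by rewrite fps_trunc_mul ?bmdeg.
Qed.

Lemma fps_mulC : commutative fps_mul.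
Proof.
by move=> s t; apply: fpsP => m; rewrite !(fps_mul_trunc _ _ (ltnSn _)) mulrC.
Qed.

Lemma fps_mul1 : left_id (fpsC 1) fps_mul.
Proof.
move=> s; apply: fpsP => m; have h := ltnSn (mdeg m).
rewrite (fps_mul_trunc _ _ h) -(mcoeff_fps_trunc s h).
suff -> : fps_trunc (mdeg m).+1 (fpsC 1) = 1 by rewrite mul1r.
have h0 : (mdeg (0%MM : 'X_{1..n}) < (mdeg m).+1)%N by rewrite mdeg0.
rewrite /fps_trunc (bigD1 (BMultinom h0)) //= eqxx mulr1n scale1r mpolyX0.
rewrite big1 ?addr0 // => k; rewrite bmeqP /= => /negPf ->.
by rewrite mulr0n scale0r.
Qed.

Lemma fps_mulDl : left_distributive fps_mul fps_add.
Proof.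
move=> s t u; apply: fpsP => m /=; rewrite -big_split /=.
by apply: eq_bigr => k _; rewrite mulrDl.
Qed.

Lemma fps1_neq0 : fpsC 1 != 0.
Proof.
apply/eqP => /(congr1 (fun s => fcoef s 0%MM)) /= /eqP.
by rewrite eqxx mulr1n oner_eq0.
Qed.

HB.instance Definition _ := GRing.Zmodule_isComNzRing.Build (fps n R)
  fps_mulA fps_mulC fps_mul1 fps_mulDl fps1_neq0.

Lemma fcoef0 m : fcoef (0 : fps n R) m = 0. Proof. by []. Qed.
Lemma fcoef1 m : fcoef (1 : fps n R) m = (m == 0%MM)%:R. Proof. by []. Qed.
Lemma fcoefN s m : fcoef (- s) m = - fcoef s m. Proof. by []. Qed.
Lemma fcoefD s t m : fcoef (s + t) m = fcoef s m + fcoef t m. Proof. by []. Qed.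
Lemma fcoefM s t m : fcoef (s * t) m =
  \sum_(k : 'X_{1..n < (mdeg m).+1, (mdeg m).+1} | m == (k.1 + k.2)%MM)
     fcoef s k.1 * fcoef t k.2.
Proof. by []. Qed.

End FpsRing.

Section FpsOperations.

Variables (n : nat) (R : comNzRingType).
Implicit Types (s t : fps n R) (m : 'X_{1..n}).

Definition fps_var (i : 'I_n) : fps n R := FPS (fun m => (m == U_(i)%MM)%:R).

Definition fps_deriv (i : 'I_n) s : fps n R :=
  FPS (fun m => fcoef s (m + U_(i))%MM *+ (m i).+1).

(* order_geq d h is o(h) >= d: every nonzero term of every h i has degree at  *)
(* least d (the order of the zero series being infinite).                     *)
Definition order_geq (d p : nat) (h : 'I_p -> fps n R) : Prop :=
  forall (i : 'I_p) m, fcoef (h i) m != 0 -> (d <= mdeg m)%N.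

Definition jacobian (f : 'I_n -> fps n R) : fps n R :=
  \det (\matrix_(i < n, j < n) fps_deriv j (f i)).

(* \sum_(k >= 0) f k, for summands such that f k has order at least k, so     *)
(* that only k <= mdeg m contributes to the coefficient of m.                 *)
Definition fps_sum (f : nat -> fps n R) : fps n R :=
  FPS (fun m => \sum_(k < (mdeg m).+1) fcoef (f k) m).

Lemma fcoefM_low (a b : nat) s t :
  (forall m, (mdeg m < a)%N -> fcoef s m = 0) ->
  (forall m, (mdeg m < b)%N -> fcoef t m = 0) ->
  forall m, (mdeg m < a + b)%N -> fcoef (s * t) m = 0.
Proof.
move=> sa tb m lt_m; rewrite fcoefM big1 // => -[k1 k2] /= /eqP def_m.
case: (ltnP (mdeg k1) a) => [/sa-> | le_a]; first by rewrite mul0r.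
rewrite tb ?mulr0 // -(ltn_add2l a); apply: leq_ltn_trans lt_m.
by rewrite [in leqRHS]def_m mdegD leq_add2r.
Qed.

Lemma fcoefX_low s (k : nat) m :
  fcoef s 0%MM = 0 -> (mdeg m < k)%N -> fcoef (s ^+ k) m = 0.
Proof.
move=> s0; elim: k m => // k IHk m lt_mk.
rewrite exprS (fcoefM_low (a := 1) (b := k)) // => m'.
by rewrite ltnS leqn0 mdeg_eq0 => /eqP->.
Qed.

End FpsOperations.

(* e^s, for a series s without constant term over a ring where the k! are     *)
(* invertible; s ^+ k then has order at least k by fcoefX_low.                *)
Definition fps_exp (n : nat) (K : fieldType) (s : fps n K) : fps n K :=
  fps_sum (fun k => fpsC n (k`!%:R^-1) * s ^+ k).

(* The substitution q(g_1, ..., g_n), for series g i without constant term,   *)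
(* as the sum over k of its degree k part in g, which has order at least k.   *)
Definition fps_comp (n p : nat) (R : comNzRingType)
    (q : fps n R) (g : 'I_n -> fps p R) : fps p R :=
  fps_sum (fun k =>
    \sum_(m : 'X_{1..n < k.+1} | mdeg m == k)
       fpsC p (fcoef q m) * \prod_(i < n) g i ^+ m i).

Lemma fcoef_prod_low (n p : nat) (R : comNzRingType) (g : 'I_n -> fps p R)
    (e : 'X_{1..n}) (m : 'X_{1..p}) :
  (forall i, fcoef (g i) 0%MM = 0) -> (mdeg m < mdeg e)%N ->
  fcoef (\prod_(i < n) g i ^+ e i) m = 0.
Proof.
move=> g0; rewrite (mdegE e); pose P (s : fps p R) (a : nat) :=
  forall m, (mdeg m < a)%N -> fcoef s m = 0.
suff: P (\prod_(i < n) g i ^+ e i) (\sum_(i < n) e i)%N by apply.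
apply: (big_ind2 P) => [m' | s a t b sa tb m' | i _ m']; first by rewrite ltn0.
  exact: fcoefM_low.
exact: fcoefX_low.
Qed.

Definition formal_inverse (n : nat) (R : comNzRingType)
    (F G : 'I_n -> fps n R) : Prop :=
  (forall i, fps_comp (F i) G = fps_var R i) /\
  (forall i, fps_comp (G i) F = fps_var R i).

(* The 2n variables (xi, z) are indexed by 'I_(n + n): xi_i is the variable   *)
(* lshift n i and z_i is the variable rshift n i.                             *)

Definition xi_exp (n : nat) (m : 'X_{1..n + n}) : 'X_{1..n} :=
  [multinom m (lshift n i) | i < n].

Definition z_exp (n : nat) (m : 'X_{1..n + n}) : 'X_{1..n} :=
  [multinom m (rshift n i) | i < n].

Definition grade (n : nat) (m : 'X_{1..n + n}) : int :=
  (mdeg (z_exp m))%:Z - (mdeg (xi_exp m))%:Z.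

(* The inclusion of K[[z]] in K[[xi, z]].                                     *)
Definition in_z (n : nat) (R : comNzRingType) (s : fps n R) : fps (n + n) R :=
  FPS (fun m => if xi_exp m == 0%MM then fcoef s (z_exp m) else 0).

Definition xi_pairing (n : nat) (R : comNzRingType) (h : 'I_n -> fps n R) :
    fps (n + n) R :=
  \sum_(i < n) fps_var R (lshift n i) * in_z (h i).

Section GradingAndPhi.

Variables (n : nat) (K : fieldType).
Implicit Types (p : {mpoly K[n + n]}) (d : int).

(* The homogeneous component A_d[xi, z].                                      *)
Definition graded_part d : pred {mpoly K[n + n]} :=
  fun p => all (fun m => grade m == d) (msupp p).

Definition Lambda p : {mpoly K[n + n]} :=
  \sum_(i < n) p^`M(rshift n i)^`M(lshift n i).

(* e^Lambda; the omitted terms vanish by Lambda_nilp.                         *)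
Definition exp_Lambda p : {mpoly K[n + n]} :=
  \sum_(k < msize p) k`!%:R^-1 *: iter k Lambda p.

Lemma graded_partP d p :
  reflect (forall m, p@_m != 0 -> grade m = d) (graded_part d p).
Proof.
apply: (iffP allP) => h m; first by rewrite -mcoeff_msupp => /h/eqP.
by rewrite mcoeff_msupp => /h ->.
Qed.

Lemma graded_part0 d : graded_part d 0.
Proof. by apply/graded_partP => m; rewrite mcoeff0 eqxx. Qed.

Lemma graded_partD d p q :
  graded_part d p -> graded_part d q -> graded_part d (p + q).
Proof.
move=> /graded_partP hp /graded_partP hq; apply/graded_partP => m.
rewrite mcoeffD; have [-> | /hp //] := eqVneq p@_m 0.
by rewrite add0r => /hq.
Qed.

Lemma graded_partZ d (c : K) p : graded_part d p -> graded_part d (c *: p).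
Proof.
move=> /graded_partP hp; apply/graded_partP => m.
by rewrite mcoeffZ mulf_eq0 negb_or => /andP[_ /hp].
Qed.

Lemma graded_part_sum d (I : Type) (r : seq I) (P : pred I)
    (f : I -> {mpoly K[n + n]}) :
  (forall i, P i -> graded_part d (f i)) ->
  graded_part d (\sum_(i <- r | P i) f i).
Proof.
move=> h; apply: (big_ind (graded_part d)) => //.
  exact: graded_part0.
by move=> x y; apply: graded_partD.
Qed.

Lemma grade_shift (m : 'X_{1..n + n}) i :
  grade (m + U_(lshift n i) + U_(rshift n i))%MM = grade m.
Proof.
have xiE : xi_exp (m + U_(lshift n i) + U_(rshift n i))%MM
           = (xi_exp m + U_(i))%MM.
  apply/mnmP => j; rewrite mnmDE !mnmE.
  by rewrite (inj_eq (@lshift_inj _ _)) [rshift n i == _]eq_sym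
             eq_lrshift addn0.
have zE : z_exp (m + U_(lshift n i) + U_(rshift n i))%MM
          = (z_exp m + U_(i))%MM.
  apply/mnmP => j; rewrite mnmDE !mnmE.
  by rewrite (inj_eq (@rshift_inj _ _)) eq_lrshift addn0.
by rewrite /grade xiE zE !mdegD !mdeg1 !PoszD opprD addrACA subrr addr0.
Qed.

Lemma graded_Lambda d p : graded_part d p -> graded_part d (Lambda p).
Proof.
move=> /graded_partP hp; apply: graded_part_sum => i _.
apply/graded_partP => m; rewrite !mcoeff_mderiv => nz.
rewrite -(grade_shift m i); apply: hp; apply: contraNneq nz => ->.
by rewrite !mul0rn.
Qed.

Lemma graded_exp_Lambda d p : graded_part d p -> graded_part d (exp_Lambda p).
Proof.
move=> hp; apply: graded_part_sum => k _; apply: graded_partZ.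
by elim: (k : nat) => //= j; apply: graded_Lambda.
Qed.

Lemma Lambda_nilp p (k : nat) : (msize p <= k)%N -> iter k Lambda p = 0.
Proof.
move=> le_pk; apply/mpolyP => m; rewrite mcoeff0.
suff: forall m, (msize p <= mdeg m + k)%N -> (iter k Lambda p)@_m = 0.
  by apply; rewrite (leq_trans le_pk) ?leq_addl.
elim: k {le_pk m} => [|k IHk] m /=; rewrite ?addn0.
  by move=> le_pm; apply/eqP; rewrite mcoeff_eq0; apply: contraTN le_pm;
     rewrite -ltnNge => /msize_mdeg_lt.
move=> le_pm; rewrite /Lambda raddf_sum big1 //= => i _.
rewrite !mcoeff_mderiv IHk ?mul0rn // !mdegD !mdeg1.
by apply: leq_trans le_pm _; rewrite !addn1 !addSn addnS leqnSn.
Qed.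

(* The completion of K[xi, z]: the formal sums of the u_d, d in Z.            *)
Record completion := Completion {
  component : int -> {mpoly K[n + n]};
  component_graded : forall d, graded_part d (component d);
  component_bounded :
    exists d0 : int, forall d, (d < d0)%R -> component d = 0
}.

(* The inclusion of the completion in K[[xi, z]]: in the coefficient of m     *)
(* only the component of degree grade m contributes.                          *)
Definition completion_fps (u : completion) : fps (n + n) K :=
  FPS (fun m => (component u (grade m))@_m).

Lemma completion_fps_inj : injective completion_fps.
Proof.
move=> [u hu bu] [v hv bv] /(congr1 (@fcoef _ _)) /= eq_uv.
have euv : u = v.
  apply: funext => d; apply/mpolyP => m.
  have [<- | ne_d] := eqVneq (grade m) d; first exact: (congr1 (@^~ m) eq_uv).
  have z w (hw : forall d, graded_part d (w d)) : (w d)@_m = 0.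
    apply/eqP; apply: contraNT ne_d => nz; apply/eqP.
    by have /graded_partP := hw d; apply.
  by rewrite (z u) // (z v).
case: v / euv hv bv {eq_uv} => hv bv.
by rewrite (Prop_irrelevance hu hv) (Prop_irrelevance bu bv).
Qed.

Lemma exp_Lambda0 : exp_Lambda 0 = 0.
Proof. by rewrite /exp_Lambda msize0 big_ord0. Qed.

Lemma Phi_bounded (u : completion) :
  exists d0 : int, forall d, (d < d0)%R -> exp_Lambda (component u d) = 0.
Proof.
case: (component_bounded u) => d0 h; exists d0 => d /h ->.
exact: exp_Lambda0.
Qed.

Definition Phi (u : completion) : completion :=
  Completion (fun d => graded_exp_Lambda (component_graded u d))
             (Phi_bounded u).

End GradingAndPhi.

(* Main.v *)
From HB Require Import structures.
Require Import Defs.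
From mathcomp Require Import all_boot all_order all_algebra all_fingroup.
From mathcomp Require Import mpoly.

Set Implicit Arguments.
Unset Strict Implicit.
Unset Printing Implicit Defensive.

Import Order.TTheory GRing.Theory.
Local Open Scope ring_scope.

(** The operator Lambda is extended to formal power series in xi and z whose
    support lies in a region |z| >= 2 |xi| (the steep series, among which are
    the g(z) e^<xi, H>), where Phi := e^Lambda still makes sense. As
    [Lambda, z_j] = d/dxi_j and [Lambda, xi_j] = d/dz_j commute with Lambda,
    Phi satisfies, as soon as every term is steep,
      Phi (z_j w) = (z_j + d/dxi_j) (Phi w),
      Phi (xi_j w - dw/dz_j) = xi_j (Phi w).

    Let w = g(z) e^<xi, H>. Since dw/dxi_j = H_j w, the first rule gives
    Phi (F_j w) = z_j (Phi w): multiplication by F_j becomes multiplication by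
    z_j ([intertwined_var_sub]). By continuity multiplication by f(F) becomes
    multiplication by f ([intertwined_comp]). With f = G_j this says that z_j
    becomes G_j, and then by continuity again that q becomes q(G)
    ([intertwined_inverse]). Hence the factor q can be pulled out, and the
    theorem reduces to W = e^<xi, N> for W := Phi (JF e^<xi, H>).

    Comparing Phi (z_j w) = G_j (Phi w) with the first rule shows
    dW/dxi_j = N_j W, which also holds for e^<xi, N>. In characteristic zero a
    solution of these equations is determined by its part of degree 0 in xi
    ([xi_ode_uniq]), so what is left is that W equals 1 for xi = 0
    ([expLambda_jac_exp]).

    For this the components of H are replaced by 0 one after the other. Let
    H' arise from H by killing H_i, let F' = z - H', and let C_j be the
    cofactors of row i of the Jacobian matrix of F. Expanding JF along this row
    and putting Q := (e^<xi, H> - e^<xi, H'>) / xi_i, one finds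
      JF e^<xi, H> = JF' e^<xi, H'> + sum_j (xi_j - d/dz_j) (C_j Q)
    ([row_step]), thanks to the Piola identity sum_j dC_j/dz_j = 0 ([piola])
    and to the orthogonality of the C_j to the other rows. By the second rule
    Phi maps the sum to a series divisible by the xi_j, which vanishes for
    xi = 0. When all components are killed, Phi 1 = 1 remains. *)

(** * Power series: coefficients, derivatives and infinite sums *)

(* Otherwise simplification turns the coefficients of a product into the      *)
(* defining convolution sum.                                                  *)
Arguments fcoef {n R} _ _ : simpl never.

Section PowerSeries.

Variables (n : nat) (R : comNzRingType).
Implicit Types (s t : fps n R) (m : 'X_{1..n}) (p q : {mpoly R[n]}).

Lemma fcoefB s t m : fcoef (s - t) m = fcoef s m - fcoef t m.
Proof. by []. Qed.

Lemma fcoef_sum (I : Type) (r : seq I) (P : pred I) (f : I -> fps n R) m :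
  fcoef (\sum_(i <- r | P i) f i) m = \sum_(i <- r | P i) fcoef (f i) m.
Proof. by elim/big_rec2: _ => // i x y _ <-. Qed.

Lemma fcoefMn s k m : fcoef (s *+ k) m = fcoef s m *+ k.
Proof. by elim: k => // k IHk; rewrite !mulrS fcoefD IHk. Qed.

(** A coefficient of a product only involves coefficients of the factors in no
    larger degree, so product identities of polynomials carry over to series. *)
Lemma fcoefM_mpoly s t p q m :
  (forall k, (mdeg k <= mdeg m)%N -> p@_k = fcoef s k) ->
  (forall k, (mdeg k <= mdeg m)%N -> q@_k = fcoef t k) ->
  fcoef (s * t) m = (p * q)@_m.
Proof.
move=> ps qt; rewrite fcoefM (mcoeff_poly_mul _ _ (ltnSn (mdeg m))) /=.
apply: eq_bigr => -[k1 k2] /= _.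
by rewrite ps ?qt // -ltnS bmdeg.
Qed.

Lemma fps_truncE d s m : (mdeg m <= d)%N -> (fps_trunc d.+1 s)@_m = fcoef s m.
Proof. by move=> le_md; rewrite mcoeff_fps_trunc. Qed.

Lemma fcoef_fpsC (c : R) m : fcoef (fpsC n c) m = c *+ (m == 0%MM).
Proof. by []. Qed.

Lemma fpsC1 : fpsC n (1 : R) = 1. Proof. by []. Qed.

Lemma fcoefCM (c : R) s m : fcoef (fpsC n c * s) m = c * fcoef s m.
Proof.
rewrite (@fcoefM_mpoly _ _ c%:MP (fps_trunc (mdeg m).+1 s)).
- by rewrite mcoeffCM fps_truncE.
- by move=> k _; rewrite mcoeffC fcoef_fpsC mulr_natr.
- by move=> k; apply: fps_truncE.
Qed.

Lemma fcoef_var i m : fcoef (fps_var R i) m = (m == U_(i)%MM)%:R.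
Proof. by []. Qed.

Lemma fcoef_varM_shift i s m :
  fcoef (fps_var R i * s) (m + U_(i))%MM = fcoef s m.
Proof.
rewrite mulrC.
rewrite (@fcoefM_mpoly _ _ (fps_trunc (mdeg m).+2 s) 'X_i).
- by rewrite addmC mcoeffMX fps_truncE.
- by move=> k; rewrite mdegD mdeg1 addn1; apply: fps_truncE.
- by move=> k _; rewrite mcoeffX eq_sym.
Qed.

Lemma fcoef_varM0 i s m : m i = 0%N -> fcoef (fps_var R i * s) m = 0.
Proof.
move=> m0; rewrite fcoefM big1 // => -[k1 k2] /= /eqP def_m.
rewrite fcoef_var; case: eqVneq => [k1E|_]; last by rewrite mul0r.
have := congr1 (fun k : 'X_{1..n} => k i) def_m.
by rewrite /= m0 mnmDE k1E mnm1E eqxx.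
Qed.

Lemma mnm_pred i m : m i != 0%N -> m = (m - U_(i) + U_(i))%MM.
Proof.
move=> mi; apply/mnmP => j; rewrite mnmDE mnmBE mnm1E.
by case: eqVneq => [<-|_]; rewrite ?subnK ?lt0n // subn0 addn0.
Qed.

Lemma fps_varM_inj i : injective (fun s => fps_var R i * s).
Proof.
move=> s t /= eq_st; apply: fpsP => m.
by rewrite -(fcoef_varM_shift i s) eq_st fcoef_varM_shift.
Qed.

Lemma fcoef_deriv i s m :
  fcoef (fps_deriv i s) m = fcoef s (m + U_(i))%MM *+ (m i).+1.
Proof. by []. Qed.

Fact fps_deriv_zmod i : zmod_morphism (@fps_deriv n R i).
Proof.
by move=> s t; apply: fpsP => m; rewrite fcoefB !fcoef_deriv fcoefB mulrnBl.
Qed.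

HB.instance Definition _ i :=
  GRing.isZmodMorphism.Build (fps n R) (fps n R) (@fps_deriv n R i)
    (fps_deriv_zmod i).

Lemma fps_derivM i s t :
  fps_deriv i (s * t) = fps_deriv i s * t + s * fps_deriv i t.
Proof.
apply: fpsP => m; rewrite fcoef_deriv fcoefD.
have dp (u : fps n R) k : (mdeg k <= mdeg m)%N ->
    ((fps_trunc (mdeg m).+2 u)^`M(i))@_k = fcoef (fps_deriv i u) k.
  move=> le_km; rewrite mcoeff_mderiv fcoef_deriv fps_truncE //.
  by rewrite mdegD mdeg1 addn1.
have p (u : fps n R) k : (mdeg k <= mdeg m)%N ->
    (fps_trunc (mdeg m).+2 u)@_k = fcoef u k.
  by move=> le_km; rewrite fps_truncE // leqW.
rewrite (@fcoefM_mpoly _ _ _ _ _ (dp s) (p t)).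
rewrite (@fcoefM_mpoly _ _ _ _ _ (p s) (dp t)).
rewrite -mcoeffD -mderivM mcoeff_mderiv; congr (_ *+ _).
by apply: fcoefM_mpoly => k; rewrite mdegD mdeg1 addn1; apply: fps_truncE.
Qed.

Lemma fps_derivC i (c : R) : fps_deriv i (fpsC n c) = 0.
Proof.
apply: fpsP => m; rewrite fcoef_deriv fcoef_fpsC.
by rewrite mnmD_eq0 mnm1_eq0 andbF mulr0n mul0rn.
Qed.

Lemma fps_derivCM i (c : R) s :
  fps_deriv i (fpsC n c * s) = fpsC n c * fps_deriv i s.
Proof. by rewrite fps_derivM fps_derivC mul0r add0r. Qed.

Lemma fps_deriv_var i j : fps_deriv i (fps_var R j) = (i == j)%:R :> fps n R.
Proof.
apply: fpsP => m; rewrite fcoef_deriv fcoef_var.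
have [->|ij] := eqVneq i j.
  rewrite mulr1n fcoef1 -[X in _ == X]add0m eqm_add2r.
  by case: eqVneq => [->|]; rewrite ?mul0rn // mnm0E.
rewrite mulr0n fcoef0; case: eqVneq => [/mnmP/(_ i)|]; rewrite ?mul0rn //.
by rewrite mnmDE !mnm1E eqxx eq_sym (negPf ij) addn1.
Qed.

Lemma fps_derivX i s k :
  fps_deriv i (s ^+ k.+1) = (s ^+ k * fps_deriv i s) *+ k.+1.
Proof.
elim: k => [|k IHk]; first by rewrite expr0 mul1r.
rewrite exprS fps_derivM IHk mulrnAr mulrA -exprS.
by rewrite [fps_deriv i s * _]mulrC -mulrS.
Qed.

Lemma fps_deriv_comm i j s :
  fps_deriv i (fps_deriv j s) = fps_deriv j (fps_deriv i s).
Proof.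
apply: fpsP => m; rewrite !fcoef_deriv !mnmDE !mnm1E.
rewrite -!mulrnA -addmA [(U_(i) + _)%MM]addmC addmA; congr (_ *+ _).
by case: eqVneq => [->|ij] //=; rewrite ?addn0 mulnC.
Qed.

Definition low_order (d : nat) s : Prop :=
  forall m, (mdeg m < d)%N -> fcoef s m = 0.

Definition summable (f : nat -> fps n R) : Prop :=
  forall k, low_order k (f k).

Lemma low_orderMr d s t : low_order d t -> low_order d (s * t).
Proof. by move=> tL m; apply: (fcoefM_low (a := 0%N)) => // m'. Qed.

Lemma fcoef_fps_sumE (f : nat -> fps n R) m :
  fcoef (fps_sum f) m = \sum_(k < (mdeg m).+1) fcoef (f k) m.
Proof. by []. Qed.

Lemma fcoef_fps_sum (f : nat -> fps n R) (d : nat) m :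
  summable f -> (mdeg m < d)%N ->
  fcoef (fps_sum f) m = \sum_(k < d) fcoef (f k) m.
Proof.
move=> fS lt_md; rewrite fcoef_fps_sumE.
rewrite -!(big_mkord xpredT (fun k => fcoef (f k) m)).
rewrite [RHS](@big_cat_nat _ _ _ (mdeg m).+1) //=.
rewrite [X in _ + X]big_nat_cond [X in _ + X]big1 ?addr0 // => k.
by rewrite andbT => /andP[+ _]; apply: fS.
Qed.

(** Multiplication by a series never lowers the order, hence it commutes with
    convergent infinite sums. *)
Lemma fps_sumMr (a : fps n R) (f : nat -> fps n R) : summable f ->
  fps_sum (fun k => a * f k) = a * fps_sum f.
Proof.
move=> fS; apply: fpsP => m; rewrite fcoefM.
transitivity (\sum_(k < (mdeg m).+1) fcoef (a * f k) m) => //.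
under eq_bigr do rewrite fcoefM.
rewrite exchange_big /=; apply: eq_bigr => -[k1 k2] /= _.
by rewrite -mulr_sumr; congr (_ * _); rewrite -(fcoef_fps_sum fS) ?bmdeg.
Qed.

End PowerSeries.

(** * Substitution and exponentials of power series *)

Section Comp.
Variables (n p : nat) (R : comNzRingType).

Lemma fps_sum_tail (f : nat -> fps n R) d :
  summable f -> low_order d (fps_sum f - \sum_(k < d) f k).
Proof.
move=> fS m lt_md.
by rewrite fcoefB fcoef_sum (fcoef_fps_sum fS lt_md) subrr.
Qed.

(** The summand of index [k] in the definition of [fps_comp q g]. As its order
    is at least [k], finitely many of these approximate [fps_comp q g] up to any
    prescribed degree. *)
Definition comp_part (q : fps n R) (g : 'I_n -> fps p R) (k : nat) : fps p R :=
  \sum_(m : 'X_{1..n < k.+1} | mdeg m == k)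
       fpsC p (fcoef q m) * \prod_(i < n) g i ^+ m i.

Lemma comp_part_summable (q : fps n R) (g : 'I_n -> fps p R) :
  (forall i, fcoef (g i) 0%MM = 0) -> summable (comp_part q g).
Proof.
move=> g0 k m lt_mk; rewrite fcoef_sum big1 // => e /eqP ek.
by rewrite fcoefCM fcoef_prod_low ?mulr0 ?ek.
Qed.

End Comp.

Section CompVar.
Variables (n : nat) (R : comNzRingType).

Lemma fcoef_monomial (e m : 'X_{1..n}) :
  fcoef (\prod_(i < n) fps_var R i ^+ e i) m = (m == e)%:R.
Proof.
pose tr (s : fps n R) (q : {mpoly R[n]}) := forall k, q@_k = fcoef s k.
have trM s1 q1 s2 q2 : tr s1 q1 -> tr s2 q2 -> tr (s1 * s2) (q1 * q2).
  by move=> h1 h2 k; rewrite (@fcoefM_mpoly _ _ _ _ q1 q2).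
have tr1 : tr 1 1 by move=> k; rewrite mcoeff1.
suff /(_ m) <- : tr (\prod_(i < n) fps_var R i ^+ e i) 'X_[e].
  by rewrite mcoeffX eq_sym.
rewrite mpolyXE_id; apply: (big_ind2 tr) => // i _.
have tri : tr (fps_var R i) 'X_i by move=> k; rewrite mcoeffX eq_sym.
by elim: (e i) => [|k IHk]; rewrite ?expr0 // !exprS; apply: trM.
Qed.

Lemma fps_comp_var (f : fps n R) : fps_comp f (fps_var R) = f.
Proof.
apply: fpsP => m.
transitivity (\sum_(k < (mdeg m).+1) fcoef (comp_part f (fps_var R) k) m) => //.
under eq_bigr do rewrite fcoef_sum.
under eq_bigr do under eq_bigr do rewrite fcoefCM fcoef_monomial.
rewrite (bigD1 ord_max) // (bigD1 (BMultinom (ltnSn (mdeg m)))) //=.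
rewrite eqxx mulr1 big1 => [|e /andP[_]].
  rewrite big1 ?addr0 // => k /negPf km; rewrite big1 // => e /eqP ek.
  case: eqVneq => [me|_]; last by rewrite mulr0.
  by case/eqP: km; apply: val_inj; rewrite /= -ek -me.
by rewrite bmeqP /= eq_sym => /negPf ->; rewrite mulr0.
Qed.
End CompVar.

Section Exp.
Variables (n : nat) (K : fieldType).
Hypothesis charK0 : [pchar K] =i pred0.

Lemma factS_inv k : (k.+1)`!%:R^-1 *+ k.+1 = k`!%:R^-1 :> K.
Proof.
rewrite factS natrM invfM -mulrnAl -mulr_natl mulfV ?mul1r //.
by move/pcharf0P: charK0 => ->.
Qed.

Lemma exp_summable (s : fps n K) :
  fcoef s 0%MM = 0 -> summable (fun k => fpsC n (k`!%:R^-1) * s ^+ k).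
Proof. by move=> s0 k m lt_mk; rewrite fcoefCM fcoefX_low // mulr0. Qed.

(** Termwise differentiation: the derivative of [s ^+ k.+1 / k.+1`!] is
    [s ^+ k / k`!] times that of [s]. The constant term of the sum drops out,
    which accounts for the index shift. *)
Lemma fps_deriv_exp i (s : fps n K) : fcoef s 0%MM = 0 ->
  fps_deriv i (fps_exp s) = fps_deriv i s * fps_exp s.
Proof.
move=> s0; rewrite -(fps_sumMr _ (exp_summable s0)); apply: fpsP => m.
rewrite fcoef_deriv.
rewrite (fcoef_fps_sum (d := (mdeg m).+2) (exp_summable s0)); last first.
  by rewrite mdegD mdeg1 addn1.
rewrite -sumrMnl; under eq_bigr do rewrite -fcoef_deriv.
rewrite big_ord_recl expr0 mulr1 fps_derivC fcoef0 add0r.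
apply: eq_bigr => k _; rewrite lift0 fps_derivCM fps_derivX.
rewrite [in RHS]mulrCA !fcoefCM fcoefMn.
by rewrite [fps_deriv i s * _]mulrC -(factS_inv k) mulrnAl mulrnAr.
Qed.

End Exp.

(** * The variables xi and z *)

Section SplitExponents.
Variable n : nat.
Implicit Types (m : 'X_{1..n + n}) (k : 'X_{1..n}).

Lemma xi_expE m i : xi_exp m i = m (lshift n i).
Proof. exact: mnmE. Qed.

Lemma z_expE m i : z_exp m i = m (rshift n i).
Proof. exact: mnmE. Qed.

Lemma xi_expD m1 m2 : xi_exp (m1 + m2) = (xi_exp m1 + xi_exp m2)%MM.
Proof. by apply/mnmP => i; rewrite mnmDE !xi_expE mnmDE. Qed.

Lemma z_expD m1 m2 : z_exp (m1 + m2) = (z_exp m1 + z_exp m2)%MM.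
Proof. by apply/mnmP => i; rewrite mnmDE !z_expE mnmDE. Qed.

Lemma xi_exp0 : xi_exp (0%MM : 'X_{1..n + n}) = 0%MM.
Proof. by apply/mnmP => i; rewrite xi_expE !mnm0E. Qed.

Lemma z_exp0 : z_exp (0%MM : 'X_{1..n + n}) = 0%MM.
Proof. by apply/mnmP => i; rewrite z_expE !mnm0E. Qed.

Lemma xi_exp_lshift i : xi_exp U_(lshift n i) = U_(i)%MM.
Proof.
by apply/mnmP => j; rewrite xi_expE !mnm1E (inj_eq (@lshift_inj _ _)).
Qed.

Lemma z_exp_lshift i : z_exp U_(lshift n i) = 0%MM.
Proof. by apply/mnmP => j; rewrite z_expE mnm1E mnm0E eq_lrshift. Qed.

Lemma xi_exp_rshift i : xi_exp U_(rshift n i) = 0%MM.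
Proof. by apply/mnmP => j; rewrite xi_expE mnm1E mnm0E eq_rlshift. Qed.

Lemma z_exp_rshift i : z_exp U_(rshift n i) = U_(i)%MM.
Proof.
by apply/mnmP => j; rewrite z_expE !mnm1E (inj_eq (@rshift_inj _ _)).
Qed.

Lemma eq_split_exp m1 m2 :
  (m1 == m2) = (xi_exp m1 == xi_exp m2) && (z_exp m1 == z_exp m2).
Proof.
apply/eqP/andP => [-> // | [/eqP/mnmP xE /eqP/mnmP zE]].
apply/mnmP => i; case: (split_ordP i) => j ->.
  by rewrite -!xi_expE xE.
by rewrite -!z_expE zE.
Qed.

Lemma mdeg_split m : mdeg m = (mdeg (xi_exp m) + mdeg (z_exp m))%N.
Proof.
rewrite !mdegE big_split_ord /=.
by congr (_ + _)%N; apply: eq_bigr => i _; rewrite ?xi_expE ?z_expE.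
Qed.

End SplitExponents.

Section InZ.
Variables (n : nat) (R : comNzRingType).
Implicit Types (m : 'X_{1..n + n}) (k : 'X_{1..n}) (s t : fps n R).

Let zvars : n.-tuple {mpoly R[n + n]} := [tuple 'X_(rshift n i) | i < n].

(** On polynomials, [in_z] is the substitution of the variables z, a ring
    morphism; this is how multiplicativity of [in_z] is obtained. *)
Lemma mcoeff_comp_zvars (p : {mpoly R[n]}) m :
  (p \mPo zvars)@_m = if xi_exp m == 0%MM then p@_(z_exp m) else 0.
Proof.
have XE k : ('X_[k] \mPo zvars)@_m = ((xi_exp m == 0%MM) && (z_exp m == k))%:R.
  pose k' : 'X_{1..n + n} :=
    [multinom match split i with inl _ => 0%N | inr j => k j end | i < n + n].
  have xk' : xi_exp k' = 0%MM.
    apply/mnmP => i; rewrite xi_expE mnmE mnm0E.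
    by rewrite (unsplitK (inl i : 'I_n + 'I_n)%type).
  have zk' : z_exp k' = k.
    apply/mnmP => i; rewrite z_expE mnmE.
    by rewrite (unsplitK (inr i : 'I_n + 'I_n)%type).
  have -> : 'X_[k] \mPo zvars = 'X_[k'].
    rewrite comp_mpolyX mpolyXE_id big_split_ord /=
      [X in _ = X * _]big1 ?mul1r => [|i _].
      by apply: eq_bigr => i _; rewrite tnth_mktuple -z_expE zk'.
    by rewrite -xi_expE xk' mnm0E expr0.
  by rewrite mcoeffX eq_sym eq_split_exp xk' zk'.
rewrite comp_mpolyEX raddf_sum /=.
under eq_bigr do rewrite mcoeffZ XE.
case: (xi_exp m == 0%MM) => /=; last by rewrite big1 // => k _; rewrite mulr0.
rewrite [p in RHS]mpolyE raddf_sum /=.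
by apply: eq_bigr => k _; rewrite mcoeffZ mcoeffX eq_sym.
Qed.

Lemma fcoef_in_z s m :
  fcoef (in_z s) m = if xi_exp m == 0%MM then fcoef s (z_exp m) else 0.
Proof. by []. Qed.

Fact in_z_zmod : zmod_morphism (@in_z n R).
Proof.
move=> s t; apply: fpsP => m; rewrite fcoefB !fcoef_in_z fcoefB.
by case: ifP => // _; rewrite subr0.
Qed.

Fact in_z_monoid : monoid_morphism (@in_z n R).
Proof.
split.
  apply: fpsP => m; rewrite fcoef_in_z !fcoef1 [m == _]eq_split_exp.
  by rewrite xi_exp0 z_exp0; case: ifP.
move=> s t; apply: fpsP => m.
have pE (u : fps n R) (k : 'X_{1..n + n}) : (mdeg k <= mdeg m)%N ->
    (fps_trunc (mdeg m).+1 u \mPo zvars)@_k = fcoef (in_z u) k.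
  move=> le_km; rewrite mcoeff_comp_zvars fcoef_in_z fps_truncE //.
  by apply: leq_trans le_km; rewrite [leqRHS]mdeg_split leq_addl.
rewrite (fcoefM_mpoly (pE s) (pE t)) -rmorphM mcoeff_comp_zvars fcoef_in_z.
case: ifP => // _; apply: fcoefM_mpoly => k le_km; apply: fps_truncE;
  by rewrite (leq_trans le_km) // [leqRHS]mdeg_split leq_addl.
Qed.

HB.instance Definition _ :=
  GRing.isZmodMorphism.Build (fps n R) (fps (n + n) R) (@in_z n R) in_z_zmod.
HB.instance Definition _ :=
  GRing.isMonoidMorphism.Build (fps n R) (fps (n + n) R) (@in_z n R)
    in_z_monoid.

Lemma in_z_var i : in_z (fps_var R i) = fps_var R (rshift n i).
Proof.
apply: fpsP => m; rewrite fcoef_in_z !fcoef_var [m == _]eq_split_exp.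
by rewrite xi_exp_rshift z_exp_rshift; case: ifP.
Qed.

Lemma in_zC (c : R) : in_z (fpsC n c) = fpsC (n + n) c.
Proof.
apply: fpsP => m; rewrite fcoef_in_z !fcoef_fpsC [m == _]eq_split_exp.
by rewrite xi_exp0 z_exp0; case: ifP.
Qed.

Lemma deriv_z_in_z i s :
  fps_deriv (rshift n i) (in_z s) = in_z (fps_deriv i s).
Proof.
apply: fpsP => m; rewrite fcoef_deriv !fcoef_in_z xi_expD xi_exp_rshift addm0.
case: ifP => // _; last by rewrite mul0rn.
by rewrite fcoef_deriv z_expD z_exp_rshift z_expE.
Qed.

Lemma deriv_xi_in_z i s : fps_deriv (lshift n i) (in_z s) = 0.
Proof.
apply: fpsP => m; rewrite fcoef_deriv !fcoef_in_z xi_expD xi_exp_lshift.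
by rewrite mnmD_eq0 mnm1_eq0 andbF mul0rn.
Qed.

End InZ.

(** * Steep series and the operator Lambda *)

Section Slope.
Variables (n : nat) (R : comNzRingType).
Implicit Types (m : 'X_{1..n + n}) (w v : fps (n + n) R) (c d : nat).

(** The support lies in the region |z| >= 2 |xi| + c. This is where the
    hypothesis that H has order at least 2 enters: the series e^<xi, H> is
    steep. Steepness increases by one under Lambda, which makes the sum of the
    Lambda^k w / k! converge coefficientwise. *)
Definition steep c w : Prop :=
  forall m, (mdeg (z_exp m) < (mdeg (xi_exp m)).*2 + c)%N -> fcoef w m = 0.

Lemma steepW c d w : (d <= c)%N -> steep c w -> steep d w.
Proof.
move=> le_dc wS m lt_m; apply: wS; apply: leq_trans lt_m _.
by rewrite leq_add2l.
Qed.

Lemma steep_low_order c w : steep c w -> low_order c w.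
Proof.
move=> wS m lt_mc; apply: wS; rewrite mdeg_split in lt_mc.
apply: leq_ltn_trans (leq_addl _ _) (leq_trans lt_mc (leq_addl _ _)).
Qed.

Lemma steepD c w v : steep c w -> steep c v -> steep c (w + v).
Proof. by move=> wS vS m lt_m; rewrite fcoefD wS ?vS ?addr0. Qed.

Lemma steepB c w v : steep c w -> steep c v -> steep c (w - v).
Proof. by move=> wS vS m lt_m; rewrite fcoefB wS ?vS ?subr0. Qed.

Lemma steep_sum c (I : Type) (r : seq I) (P : pred I) (f : I -> fps (n + n) R) :
  (forall i, P i -> steep c (f i)) -> steep c (\sum_(i <- r | P i) f i).
Proof.
by move=> fS; apply: (big_ind (steep c)) => //; apply: steepD.
Qed.

Lemma steepM c d w v : steep c w -> steep d v -> steep (c + d) (w * v).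
Proof.
move=> wS vS m lt_m; rewrite fcoefM big1 // => -[k1 k2] /= /eqP def_m.
have [/wS-> | le1] := ltnP (mdeg (z_exp k1)) ((mdeg (xi_exp k1)).*2 + c).
  by rewrite mul0r.
rewrite [fcoef v _]vS ?mulr0 // ltnNge; apply/negP => le2.
move: lt_m; rewrite def_m xi_expD z_expD !mdegD doubleD.
by rewrite addnACA ltnNge leq_add.
Qed.

Lemma steepMl c w v : steep c w -> steep 0 v -> steep c (w * v).
Proof. by rewrite -{2}[c]addn0; apply: steepM. Qed.

Lemma steepMr c w v : steep 0 w -> steep c v -> steep c (w * v).
Proof. by rewrite -{2}[c]add0n; apply: steepM. Qed.

Lemma steepC (a : R) : steep 0 (fpsC (n + n) a).
Proof.
move=> m; rewrite fcoef_fpsC; case: eqVneq => // ->.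
by rewrite xi_exp0 z_exp0 mdeg0.
Qed.

Lemma steepX w k : steep 0 w -> steep 0 (w ^+ k).
Proof.
move=> wS; elim: k => [|k IHk]; first exact: steepC.
by rewrite exprS; apply: steepMl.
Qed.

Lemma steep_in_z c (s : fps n R) : low_order c s -> steep c (in_z s).
Proof.
move=> sL m; rewrite fcoef_in_z; case: eqVneq => // ->.
by rewrite mdeg0 add0n; apply: sL.
Qed.

Lemma steep_in_z0 (s : fps n R) : steep 0 (in_z s).
Proof. exact: steep_in_z. Qed.

Lemma steep_xiM c i w : steep c.+2 w -> steep c (fps_var R (lshift n i) * w).
Proof.
move=> wS m lt_m; have [m0|mi] := eqVneq (m (lshift n i)) 0%N.
  exact: fcoef_varM0.
move: lt_m; rewrite (mnm_pred mi) fcoef_varM_shift.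
rewrite xi_expD z_expD xi_exp_lshift z_exp_lshift addm0 mdegD mdeg1 addn1.
by move=> lt_m; apply: wS; rewrite -[c.+2]add2n addnA addn2.
Qed.

Lemma steep_deriv_z c i w :
  steep c.+1 w -> steep c (fps_deriv (rshift n i) w).
Proof.
move=> wS m lt_m; rewrite fcoef_deriv wS ?mul0rn //.
rewrite xi_expD z_expD xi_exp_rshift z_exp_rshift addm0 mdegD mdeg1.
by rewrite addn1 addnS.
Qed.

Lemma steep_deriv_xi c i w :
  steep c w -> steep c (fps_deriv (lshift n i) w).
Proof.
move=> wS m lt_m; rewrite fcoef_deriv wS ?mul0rn //.
rewrite xi_expD z_expD xi_exp_lshift z_exp_lshift addm0 mdegD mdeg1.
by rewrite (leq_trans lt_m) // leq_add2r leq_double leq_addr.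
Qed.

Lemma steep_fps_sum c f : (forall k, steep c (f k)) -> steep c (fps_sum f).
Proof.
by move=> fS m lt_m; rewrite fcoef_fps_sumE big1 // => k _; apply: fS.
Qed.

Definition fps_Lambda w : fps (n + n) R :=
  \sum_(i < n) fps_deriv (lshift n i) (fps_deriv (rshift n i) w).

Fact fps_Lambda_zmod : zmod_morphism fps_Lambda.
Proof.
move=> w v; rewrite /fps_Lambda -sumrB.
by apply: eq_bigr => i _; rewrite !raddfB.
Qed.

HB.instance Definition _ :=
  GRing.isZmodMorphism.Build (fps (n + n) R) (fps (n + n) R) fps_Lambda
    fps_Lambda_zmod.

Lemma iter_LambdaB k w v :
  iter k fps_Lambda (w - v) = iter k fps_Lambda w - iter k fps_Lambda v.
Proof. by elim: k => //= k ->; rewrite raddfB. Qed.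

(** Lambda lowers |xi| and |z| by one each, so it raises |z| - 2 |xi| by one. *)
Lemma steep_Lambda c w : steep c w -> steep c.+1 (fps_Lambda w).
Proof.
move=> wS; apply: steep_sum => i _ m lt_m; rewrite !fcoef_deriv.
rewrite wS ?mul0rn // !xi_expD !z_expD xi_exp_lshift xi_exp_rshift.
rewrite z_exp_lshift z_exp_rshift !addm0 !mdegD !mdeg1 doubleD.
by rewrite addn1 addnAC addn2 ltnS (leq_trans lt_m) // addnS.
Qed.

Lemma steep_iter_Lambda c k w :
  steep c w -> steep (k + c) (iter k fps_Lambda w).
Proof. by move=> wS; elim: k => //= k IHk; apply: steep_Lambda. Qed.

Lemma iter_Lambda_deriv k i w :
  iter k fps_Lambda (fps_deriv i w) = fps_deriv i (iter k fps_Lambda w).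
Proof.
elim: k => //= k ->; rewrite /fps_Lambda raddf_sum /=; apply: eq_bigr => j _.
by rewrite !(fps_deriv_comm i).
Qed.

(** Leibniz rule: of all derivatives in Lambda only d/dxi_j acts on [xi_j], and
    what remains of the summand of index j is d/dz_j. *)
Lemma Lambda_xiM j w :
  fps_Lambda (fps_var R (lshift n j) * w) =
    fps_var R (lshift n j) * fps_Lambda w + fps_deriv (rshift n j) w.
Proof.
rewrite /fps_Lambda mulr_sumr.
under eq_bigr do rewrite fps_derivM fps_deriv_var eq_rlshift mul0r add0r
  fps_derivM fps_deriv_var (inj_eq (@lshift_inj _ _)) addrC.
rewrite big_split /=; congr (_ + _).
rewrite (bigD1 j) //= eqxx mul1r big1 ?addr0 // => i /negPf ->.
by rewrite mul0r.
Qed.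

Lemma Lambda_zM j w :
  fps_Lambda (fps_var R (rshift n j) * w) =
    fps_var R (rshift n j) * fps_Lambda w + fps_deriv (lshift n j) w.
Proof.
rewrite /fps_Lambda mulr_sumr.
under eq_bigr do rewrite [in X in fps_deriv (lshift _ _) X]fps_derivM
  fps_deriv_var (inj_eq (@rshift_inj _ _)) raddfD /= !fps_derivM
  fps_deriv_var eq_lrshift mul0r add0r addrC.
rewrite big_split /=; congr (_ + _).
rewrite (bigD1 j) //= eqxx mul1r big1 ?addr0 => [|i /negPf ->].
  by rewrite -[1]fpsC1 fps_derivC mul0r add0r.
by rewrite mulr0n raddf0 !mul0r addr0.
Qed.

(** Since [D := fps_deriv i], the commutator of Lambda and x, commutes with
    Lambda, the commutator of [Lambda^k] and x is [k Lambda^(k-1) D]. *)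
Lemma iter_LambdaM (x : fps (n + n) R) (i : 'I_(n + n)) :
  (forall w, fps_Lambda (x * w) = x * fps_Lambda w + fps_deriv i w) ->
  forall k w, iter k fps_Lambda (x * w) =
    x * iter k fps_Lambda w + iter k.-1 fps_Lambda (fps_deriv i w) *+ k.
Proof.
move=> xM k w; elim: k => [|k IHk] /=; first by rewrite mulr0n addr0.
rewrite IHk raddfD /= xM -addrA; congr (_ + _).
rewrite -iter_Lambda_deriv raddfMn /= mulrS; congr (_ + _).
by case: k {IHk}.
Qed.

End Slope.

(** * The exponential of Lambda on steep series *)

Section ExpLambda.
Variables (n : nat) (K : fieldType).
Implicit Types (m : 'X_{1..n + n}) (w v x : fps (n + n) K) (s g f : fps n K).

(** As [fps_sum] only adds up terms of index at most the degree, this is the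
    sum of the Lambda^k w / k! when w is steep, the k-th term then having order
    at least k. *)
Definition fps_expLambda w : fps (n + n) K :=
  fps_sum (fun k => fpsC (n + n) (k`!%:R^-1) * iter k (@fps_Lambda n K) w).

Lemma expLambda_summable w : steep 0 w ->
  summable (fun k => fpsC (n + n) (k`!%:R^-1) * iter k (@fps_Lambda n K) w).
Proof.
move=> wS k; apply/low_orderMr/steep_low_order.
by have := steep_iter_Lambda (k := k) wS; rewrite addn0.
Qed.

Lemma fcoef_expLambda d w m : steep 0 w -> (mdeg m < d)%N ->
  fcoef (fps_expLambda w) m =
    \sum_(k < d) k`!%:R^-1 * fcoef (iter k (@fps_Lambda n K) w) m.
Proof.
move=> wS lt_md; rewrite (fcoef_fps_sum (expLambda_summable wS) lt_md).
by apply: eq_bigr => k _; rewrite fcoefCM.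
Qed.

Fact fps_expLambda_zmod : zmod_morphism fps_expLambda.
Proof.
move=> w v; apply: fpsP => m; rewrite fcoefB -sumrB.
by apply: eq_bigr => k _; rewrite iter_LambdaB mulrBr fcoefB.
Qed.

HB.instance Definition _ :=
  GRing.isZmodMorphism.Build (fps (n + n) K) (fps (n + n) K) fps_expLambda
    fps_expLambda_zmod.

Lemma fps_expLambdaD w v :
  fps_expLambda (w + v) = fps_expLambda w + fps_expLambda v.
Proof. exact: raddfD. Qed.

Lemma fps_expLambda_sum (I : Type) (r : seq I) (f : I -> fps (n + n) K) :
  fps_expLambda (\sum_(i <- r) f i) = \sum_(i <- r) fps_expLambda (f i).
Proof. exact: raddf_sum. Qed.

Lemma iter_LambdaCM (a : K) k w :
  iter k (@fps_Lambda n K) (fpsC (n + n) a * w) =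
  fpsC (n + n) a * iter k (@fps_Lambda n K) w.
Proof.
elim: k => //= k ->; rewrite /fps_Lambda mulr_sumr.
by apply: eq_bigr => i _; rewrite !fps_derivCM.
Qed.

Lemma fps_expLambdaCM (a : K) w :
  fps_expLambda (fpsC (n + n) a * w) = fpsC (n + n) a * fps_expLambda w.
Proof.
apply: fpsP => m; rewrite fcoefCM !fcoef_fps_sumE mulr_sumr.
by apply: eq_bigr => k _; rewrite iter_LambdaCM mulrCA fcoefCM.
Qed.

Lemma steep_expLambda c w : steep c w -> steep c (fps_expLambda w).
Proof.
move=> wS; apply: steep_fps_sum => k; apply: steepMr; first exact: steepC.
by apply: steepW (leq_addl k c) _; apply: steep_iter_Lambda.
Qed.

Lemma expLambda_deriv_xi j w : steep 0 w ->
  fps_expLambda (fps_deriv (lshift n j) w) =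
  fps_deriv (lshift n j) (fps_expLambda w).
Proof.
move=> wS; apply: fpsP => m.
rewrite (fcoef_expLambda (d := (mdeg m).+2)) ?leqnSn //; last first.
  exact: steep_deriv_xi.
rewrite fcoef_deriv (fcoef_expLambda (d := (mdeg m).+2)) //; last first.
  by rewrite mdegD mdeg1 addn1.
rewrite -sumrMnl; apply: eq_bigr => k _.
by rewrite iter_Lambda_deriv fcoef_deriv mulrnAr.
Qed.

Hypothesis charK0 : [pchar K] =i pred0.

(** Summing the commutators of the [Lambda^k / k!] with x, one finds that x
    becomes [x + D] under conjugation by the exponential of Lambda. *)
Lemma expLambdaM x (i : 'I_(n + n)) w :
  (forall w, fps_Lambda (x * w) = x * fps_Lambda w + fps_deriv i w) ->
  steep 0 w -> steep 0 (fps_deriv i w) -> steep 0 (x * w) ->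
  fps_expLambda (x * w) = x * fps_expLambda w + fps_expLambda (fps_deriv i w).
Proof.
move=> xM wS dS xS; rewrite -(fps_sumMr _ (expLambda_summable wS)).
apply: fpsP => m; rewrite fcoefD.
(* One more term on the left than on the right: Lambda^k (x w) produces       *)
(* Lambda^(k-1) (D w).                                                        *)
rewrite (fcoef_expLambda (d := (mdeg m).+2)) ?leqnSn //.
rewrite (fcoef_expLambda (d := (mdeg m).+1) dS) //.
rewrite (fcoef_fps_sum (d := (mdeg m).+2)) ?leqnSn //; last first.
  by move=> k; apply/low_orderMr/expLambda_summable.
under eq_bigr do rewrite (iter_LambdaM xM) fcoefD mulrDr fcoefMn.
rewrite big_split /=; congr (_ + _).
  by apply: eq_bigr => k _; rewrite mulrCA fcoefCM.
rewrite big_ord_recl mulr0n mulr0 add0r; apply: eq_bigr => k _.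
by rewrite lift0 /= mulrnAr -mulrnAl factS_inv.
Qed.

Lemma expLambda_zM j w : steep 0 w ->
  fps_expLambda (fps_var K (rshift n j) * w) =
    fps_var K (rshift n j) * fps_expLambda w
    + fps_deriv (lshift n j) (fps_expLambda w).
Proof.
move=> wS; rewrite -expLambda_deriv_xi // (expLambdaM (Lambda_zM j)) //.
- exact: steep_deriv_xi.
- by rewrite -in_z_var; apply: steepMl => //; apply: steep_in_z0.
Qed.

(** The conjugate of [xi_j - d/dz_j] is [xi_j], because d/dz_j commutes with
    Lambda. In particular series of the form [xi_j w - dw/dz_j] contribute
    nothing to the part of degree 0 in xi. *)
Lemma expLambda_xiM j w : steep 2 w ->
  fps_expLambda (fps_var K (lshift n j) * w - fps_deriv (rshift n j) w) =
    fps_var K (lshift n j) * fps_expLambda w.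
Proof.
move=> wS; rewrite raddfB /= (expLambdaM (Lambda_xiM j)) ?addrK //.
- exact: steepW wS.
- by apply: steep_deriv_z; apply: steepW wS.
- exact: steep_xiM.
Qed.

(** * Exponentials linear in xi *)

Implicit Types H N : 'I_n -> fps n K.

Lemma xi_pairingM0 N w m :
  xi_exp m = 0%MM -> fcoef (xi_pairing N * w) m = 0.
Proof.
move=> m0; rewrite mulr_suml fcoef_sum big1 // => i _.
by rewrite -mulrA fcoef_varM0 // -xi_expE m0 mnm0E.
Qed.

Lemma fcoef_xi_pairing0 N : fcoef (xi_pairing N) 0%MM = 0.
Proof. by rewrite -[xi_pairing N]mulr1 xi_pairingM0 // xi_exp0. Qed.

Lemma fcoef_xi_exp0 N m : xi_exp m = 0%MM ->
  fcoef (fps_exp (xi_pairing N)) m = (m == 0%MM)%:R.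
Proof.
move=> m0.
rewrite (fcoef_fps_sum (exp_summable (fcoef_xi_pairing0 N)) (ltnSn _)).
rewrite big_ord_recl big1 ?addr0 => [|k _].
  by rewrite expr0 mulr1 fcoef_fpsC invr1.
by rewrite fcoefCM exprS xi_pairingM0 ?mulr0.
Qed.

Lemma order_geqP d N : order_geq d N -> forall i, low_order d (N i).
Proof.
move=> NL i m lt_md; apply/eqP; apply: contraTT lt_md => /NL.
by rewrite -leqNgt.
Qed.

Lemma steep_xi_exp H : order_geq 2 H -> steep 0 (fps_exp (xi_pairing H)).
Proof.
move=> /order_geqP HL; apply: steep_fps_sum => k.
apply: steepMl; first exact: steepC.
apply: steepX; apply: steep_sum => i _.
by apply: steep_xiM; apply: steep_in_z.
Qed.

Lemma deriv_xi_exp j N :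
  fps_deriv (lshift n j) (fps_exp (xi_pairing N)) =
  in_z (N j) * fps_exp (xi_pairing N).
Proof.
rewrite fps_deriv_exp ?fcoef_xi_pairing0 // raddf_sum /=; congr (_ * _).
under eq_bigr do rewrite fps_derivM fps_deriv_var (inj_eq (@lshift_inj _ _))
  deriv_xi_in_z mulr0 addr0.
rewrite (bigD1 j) //= eqxx mul1r big1 ?addr0 // => i.
by rewrite eq_sym => /negPf ->; rewrite mul0r.
Qed.

Lemma deriv_z_exp j N :
  fps_deriv (rshift n j) (fps_exp (xi_pairing N)) =
  xi_pairing (fun i => fps_deriv j (N i)) * fps_exp (xi_pairing N).
Proof.
rewrite fps_deriv_exp ?fcoef_xi_pairing0 // raddf_sum /=; congr (_ * _).
apply: eq_bigr => i _.
by rewrite fps_derivM fps_deriv_var eq_rlshift mul0r add0r deriv_z_in_z.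
Qed.

(** In characteristic zero the equations determine the coefficients of degree
    d + 1 in xi from those of degree d. *)
Lemma xi_ode_uniq N w v :
  (forall j, fps_deriv (lshift n j) w = in_z (N j) * w) ->
  (forall j, fps_deriv (lshift n j) v = in_z (N j) * v) ->
  (forall m, xi_exp m = 0%MM -> fcoef w m = fcoef v m) ->
  w = v.
Proof.
move=> wN vN wv0; apply/eqP; rewrite -subr_eq0; apply/eqP.
set u := w - v.
have uN j : fps_deriv (lshift n j) u = in_z (N j) * u.
  by rewrite raddfB /= wN vN mulrBr.
suff uL d : forall m, (mdeg (xi_exp m) <= d)%N -> fcoef u m = 0.
  by apply: fpsP => m; apply: uL (leqnn _).
elim: d => [|d IHd] m.
  by rewrite leqn0 mdeg_eq0 => /eqP/wv0; rewrite fcoefB => ->; rewrite subrr.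
have [/eqP m0|] := boolP (xi_exp m == 0%MM).
  by rewrite fcoefB wv0 // subrr.
move=> nz_m; have [i mi] : exists i, m (lshift n i) != 0%N.
  apply/existsP; apply: contraNT nz_m; rewrite negb_exists => /forallP m0.
  apply/eqP/mnmP => i; rewrite mnm0E xi_expE; apply/eqP.
  by have := m0 i; rewrite negbK.
rewrite (mnm_pred mi) xi_expD xi_exp_lshift mdegD mdeg1 addn1 ltnS.
set m' := (m - _)%MM => le_m'd.
have := congr1 (fun t => fcoef t m') (uN i).
rewrite fcoef_deriv [RHS]fcoefM big1 => [|[k1 k2] /= /eqP m'E].
  move/eqP; rewrite -mulr_natr mulf_eq0 => /orP[/eqP //|].
  by move/pcharf0P: charK0 => ->.
rewrite [fcoef u _]IHd ?mulr0 //; apply: leq_trans le_m'd.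
by rewrite [in leqRHS]m'E xi_expD mdegD leq_addl.
Qed.

(** * Substitutions intertwined by the exponential of Lambda *)

Section Intertwining.
Variable H : 'I_n -> fps n K.
Hypothesis H_order : order_geq 2 H.

Let E := fps_exp (xi_pairing H).

Lemma steep_zE c g : low_order c g -> steep c (in_z g * E).
Proof. by move=> gL; apply: steepMl (steep_in_z gL) (steep_xi_exp H_order). Qed.

(** On the space of the series g(z) e^<xi, H>, multiplication by f becomes
    multiplication by s under the exponential of Lambda. *)
Definition intertwined f s : Prop := forall g,
  fps_expLambda (in_z f * (in_z g * E)) = in_z s * fps_expLambda (in_z g * E).

Lemma intertwinedC (a : K) : intertwined (fpsC n a) (fpsC n a).
Proof. by move=> g; rewrite in_zC fps_expLambdaCM. Qed.

Lemma intertwinedM f1 s1 f2 s2 : intertwined f1 s1 -> intertwined f2 s2 ->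
  intertwined (f1 * f2) (s1 * s2).
Proof.
move=> h1 h2 g; rewrite !rmorphM /= -!mulrA [in_z f2 * _]mulrA -rmorphM.
by rewrite h1 rmorphM /= -mulrA h2.
Qed.

Lemma intertwined_sum (I : Type) (r : seq I) (P : pred I) (f s : I -> fps n K) :
  (forall i, P i -> intertwined (f i) (s i)) ->
  intertwined (\sum_(i <- r | P i) f i) (\sum_(i <- r | P i) s i).
Proof.
move=> h g; rewrite !raddf_sum !mulr_suml raddf_sum.
by apply: eq_bigr => i /h.
Qed.

Lemma intertwined_monomial (a b : 'I_n -> fps n K) (e : 'X_{1..n}) :
  (forall i, intertwined (a i) (b i)) ->
  intertwined (\prod_(i < n) a i ^+ e i) (\prod_(i < n) b i ^+ e i).
Proof.
move=> ab; apply: (big_ind2 intertwined) => [||i _].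
- exact: intertwinedC.
- by move=> *; apply: intertwinedM.
elim: (e i) => [|k IHk]; first exact: intertwinedC.
by rewrite !exprS; apply: intertwinedM.
Qed.

(** Intertwining is stable under sums and products, hence holds between
    polynomials in the [a i] and the [b i]. It passes to the limit since the
    exponential of Lambda preserves steepness: a remainder of high order in z
    has no coefficient in low degree, on either side. *)
Lemma intertwined_comp (a b : 'I_n -> fps n K) q :
  (forall i, fcoef (a i) 0%MM = 0) -> (forall i, fcoef (b i) 0%MM = 0) ->
  (forall i, intertwined (a i) (b i)) ->
  intertwined (fps_comp q a) (fps_comp q b).
Proof.
move=> a0 b0 ab g; apply: fpsP => m; set d := (mdeg m).+1.
pose A := \sum_(k < d) comp_part q a k; pose B := \sum_(k < d) comp_part q b k.
have AB : intertwined A B.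
  apply: intertwined_sum => k _; apply: intertwined_sum => e _.
  by apply: intertwinedM; [exact: intertwinedC | exact: intertwined_monomial].
have aL : low_order d (fps_comp q a - A).
  by apply: fps_sum_tail; apply: comp_part_summable.
have bL : low_order d (fps_comp q b - B).
  by apply: fps_sum_tail; apply: comp_part_summable.
rewrite -[fps_comp q a](subrK A) -[fps_comp q b](subrK B).
move: (_ - A) (_ - B) aL bL => r r' rL rL'.
rewrite !raddfD !mulrDl raddfD /= AB !fcoefD; congr (_ + _).
transitivity (0 : K); last apply: esym.
  apply: (@steep_low_order _ _ d) => //; apply: steep_expLambda.
  by apply: steepMl; [exact: steep_in_z | exact: steep_zE].
apply: (@steep_low_order _ _ d) => //; apply: steepMl; first exact: steep_in_z.
by apply/steep_expLambda/steep_zE.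
Qed.

(** The key cancellation: conjugation turns [z_j] into [z_j + d/dxi_j], while
    d/dxi_j acts on g(z) e^<xi, H> as multiplication by [H j]. *)
Lemma intertwined_var_sub j : intertwined (fps_var K j - H j) (fps_var K j).
Proof.
move=> g; rewrite raddfB /= in_z_var mulrBl raddfB /= expLambda_zM; last first.
  exact: steep_zE.
rewrite -expLambda_deriv_xi; last exact: steep_zE.
by rewrite fps_derivM deriv_xi_in_z mul0r add0r deriv_xi_exp mulrCA addrK.
Qed.

End Intertwining.
End ExpLambda.

(** * The Piola identity *)

Section Piola.
Variables (n : nat) (K : fieldType).
Hypothesis charK0 : [pchar K] =i pred0.

Lemma fps_deriv_prod (I : eqType) (r : seq I) (f : I -> fps n K) i :
  uniq r ->
  fps_deriv i (\prod_(k <- r) f k) =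
    \sum_(l <- r) fps_deriv i (f l) * \prod_(k <- r | k != l) f k.
Proof.
elim: r => [_|a r IHr /= /andP[ar /IHr Er]].
  by rewrite !big_nil -[1]fpsC1 fps_derivC.
rewrite !big_cons fps_derivM Er eqxx /=; congr (_ * _ + _).
  rewrite [RHS]big_seq_cond [LHS]big_seq; apply: eq_bigl => k.
  by case: eqVneq => [->|]; rewrite ?(negPf ar) ?andbT.
rewrite mulr_sumr; apply: eq_big_seq => l lr.
rewrite big_cons; case: eqVneq => [al|_]; first by rewrite -al (negPf ar) in lr.
by rewrite mulrCA.
Qed.

Lemma fps_eq_oppr (s : fps n K) : s = - s -> s = 0.
Proof.
move=> sN; apply: fpsP => m; apply/eqP.
have := congr1 (fun t => fcoef t m) sN; rewrite fcoefN => /eqP.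
rewrite -addr_eq0 -mulr2n -mulr_natr mulf_eq0.
by have/pcharf0P -> := charK0; rewrite orbF.
Qed.

(** The cofactors of a row of a Jacobian matrix form a field of divergence
    zero: after expansion, the second derivatives of [f l] appear once with
    indices (s i, s l) and once with (s l, s i), for two permutations that
    differ by the transposition of i and l, hence have opposite signs. *)
Lemma piola (f : 'I_n -> fps n K) i :
  \sum_j fps_deriv j
    (cofactor (\matrix_(k < n, l < n) fps_deriv l (f k)) i j) = 0.
Proof.
under eq_bigr do rewrite expand_cofactor raddf_sum /=.
rewrite (exchange_big_dep predT) //=.
pose r := [seq k <- index_enum 'I_n | i != k].
have r_uniq : uniq r by rewrite filter_uniq // index_enum_uniq.
pose T l (s : 'S_n) := (-1) ^+ s * (fps_deriv (s i) (fps_deriv (s l) (f l)) *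
  \prod_(k <- r | k != l) fps_deriv (s k) (f k)).
transitivity (\sum_s \sum_(l <- r) T l s).
  apply: eq_bigr => s _.
  rewrite (big_pred1 (s i)) => [|j]; last by rewrite eq_sym.
  have signM (b : bool) t :
      fps_deriv (s i) ((-1) ^+ b * t) = (-1) ^+ b * fps_deriv (s i) t.
    by rewrite !mulr_sign; case: b; rewrite ?raddfN.
  rewrite signM -mulr_sumr; congr (_ * _).
  under eq_bigr do rewrite mxE.
  by rewrite -big_filter fps_deriv_prod.
rewrite exchange_big big_seq big1 //= => l.
rewrite mem_filter => /andP[il _]; apply: fps_eq_oppr.
rewrite {1}(reindex_inj (mulgI (tperm i l))) /= -sumrN; apply: eq_bigr => s _.
rewrite /T odd_permM odd_tperm il addTb signrN mulNr !permM tpermL tpermR.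
rewrite fps_deriv_comm; congr (- (_ * (_ * _))).
rewrite /r !big_filter_cond; apply: eq_bigr => k /andP[ik kl].
by rewrite permM tpermD // eq_sym.
Qed.

End Piola.

(** * Elimination of the rows of the Jacobian matrix *)

Section DeltaSub.
Variables (R : comNzRingType) (n : nat) (A D : 'M[R]_n) (i0 : 'I_n).
Hypothesis A_def : forall i j, A i j = (j == i)%:R - D i j.

Let sum_delta (c : 'I_n -> R) i : \sum_j c j * (j == i)%:R = c i.
Proof.
rewrite (bigD1 i) //= eqxx mulr1 big1 ?addr0 // => j /negPf ->.
by rewrite mulr0.
Qed.

Lemma det_delta_sub :
  \det A = cofactor A i0 i0 - \sum_j cofactor A i0 j * D i0 j.
Proof.
rewrite (expand_det_row _ i0) -(sum_delta (cofactor A i0) i0) -sumrB.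
by apply: eq_bigr => j _; rewrite {1}A_def -mulrBr mulrC.
Qed.

(** The cofactors of row [i0] are orthogonal to every other row of A. *)
Lemma cofactor_delta_sub i :
  i != i0 -> \sum_j cofactor A i0 j * D i j = cofactor A i0 i.
Proof.
move=> ii0; rewrite -(sum_delta (cofactor A i0) i); apply/esym/subr0_eq.
have /matrixP/(_ i i0) := mul_mx_adj A; rewrite !mxE (negPf ii0) mulr0n.
move=> orth; rewrite -sumrB -[RHS]orth; apply: eq_bigr => j _.
by rewrite mxE {1}A_def -mulrBr mulrC.
Qed.
End DeltaSub.

Section Row.
Variables (n : nat) (K : fieldType).
Hypothesis charK0 : [pchar K] =i pred0.
Implicit Types (H : 'I_n -> fps n K) (m : 'X_{1..n + n}).

(** Replacing the component [H i0] by 0 turns row [i0] of the Jacobian matrix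
    of z - H into a row of the identity matrix. *)
Definition kill_row (i0 : 'I_n) H : 'I_n -> fps n K :=
  fun i => if i == i0 then 0 else H i.

Definition jac_mx H : 'M[fps n K]_n :=
  \matrix_(i < n, j < n) fps_deriv j (fps_var K i - H i).

Lemma jac_mxE H i j : jac_mx H i j = (j == i)%:R - fps_deriv j (H i).
Proof. by rewrite mxE raddfB /= fps_deriv_var. Qed.

Section OneRow.
Variables (H : 'I_n -> fps n K) (i0 : 'I_n).
Let H' := kill_row i0 H.
Let C j := cofactor (jac_mx H) i0 j.
Let xi i : fps (n + n) K := fps_var K (lshift n i).
Let E := fps_exp (xi_pairing H).
Let E' := fps_exp (xi_pairing H').

Lemma cofactor_kill_row j : cofactor (jac_mx H') i0 j = C j.
Proof.
rewrite /C !expand_cofactor; apply: eq_bigr => s _; congr (_ * _).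
apply: eq_bigr => k i0k.
by rewrite !jac_mxE /H' /kill_row [k == i0]eq_sym (negPf i0k).
Qed.

Lemma det_kill_row : \det (jac_mx H') = C i0.
Proof.
rewrite (expand_det_row _ i0) (bigD1 i0) //= big1 => [|j /negPf ji0].
  rewrite addr0 jac_mxE /H' /kill_row eqxx raddf0 subr0 mul1r.
  exact: cofactor_kill_row.
by rewrite jac_mxE /H' /kill_row eqxx raddf0 ji0 subr0 mul0r.
Qed.

Lemma det_jac_mx : \det (jac_mx H) = C i0 - \sum_j C j * fps_deriv j (H i0).
Proof.
pose D : 'M[fps n K]_n := \matrix_(i, j) fps_deriv j (H i).
have -> : \sum_j C j * fps_deriv j (H i0) = \sum_j C j * D i0 j.
  by apply: eq_bigr => j _; rewrite mxE.
by apply: det_delta_sub => i j; rewrite jac_mxE mxE.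
Qed.

Lemma cofactor_orth i :
  \sum_j C j * fps_deriv j (H' i) = if i == i0 then 0 else C i.
Proof.
rewrite /H' /kill_row; case: eqVneq => [_|ii0].
  by rewrite big1 // => j _; rewrite raddf0 mulr0.
pose D : 'M[fps n K]_n := \matrix_(i, j) fps_deriv j (H i).
have -> : \sum_j C j * fps_deriv j (H i) = \sum_j C j * D i j.
  by apply: eq_bigr => j _; rewrite mxE.
by apply: cofactor_delta_sub ii0 => k j; rewrite jac_mxE mxE.
Qed.

Lemma xi_pairing_split (h : 'I_n -> fps n K) :
  xi_pairing h = xi_pairing (kill_row i0 h) + xi i0 * in_z (h i0).
Proof.
rewrite /xi_pairing (bigD1 i0) //= addrC [X in _ = X + _](bigD1 i0) //=.
rewrite /kill_row eqxx raddf0 mulr0 add0r; congr (_ + _).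
by apply: eq_bigr => i /negPf ->.
Qed.

(** The quotient [(E - E') / xi i0], where [E - E'] is divisible by [xi i0]. *)
Let Q : fps (n + n) K :=
  FPS (fun m => fcoef (E - E') (m + U_(lshift n i0))%MM).

Lemma xi_divided_diff : xi i0 * Q = E - E'.
Proof.
apply: fpsP => m; have [m0|mi] := eqVneq (m (lshift n i0)) 0%N; last first.
  by rewrite (mnm_pred mi) fcoef_varM_shift.
rewrite fcoef_varM0 // fcoefB.
rewrite !(fcoef_fps_sum (exp_summable (fcoef_xi_pairing0 _)) (ltnSn _)) -sumrB.
rewrite big1 // => k _; rewrite !fcoefCM -mulrBr -fcoefB subrXX.
by rewrite [xi_pairing H]xi_pairing_split addrC addKr -mulrA fcoef_varM0 ?mulr0.
Qed.

Lemma steep_divided_diff : order_geq 2 H -> steep 2 Q.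
Proof.
move=> HL m lt_m; rewrite /Q /=.
have HL' : order_geq 2 H'.
  by move=> i k; rewrite /H' /kill_row; case: ifP => _; [case/eqP | apply: HL].
apply: (steepB (steep_xi_exp HL) (steep_xi_exp HL')).
rewrite xi_expD z_expD xi_exp_lshift z_exp_lshift addm0 mdegD mdeg1.
by rewrite addn1 doubleS addn0 -addn2.
Qed.

(** Obtained by differentiating [xi i0 * Q = E - E'] and cancelling [xi i0]. *)
Lemma deriv_z_divided_diff j :
  fps_deriv (rshift n j) Q =
    in_z (fps_deriv j (H i0)) * E +
    xi_pairing (fun i => fps_deriv j (H' i)) * Q.
Proof.
apply: (@fps_varM_inj _ _ (lshift n i0)) => /=.
have -> : fps_var K (lshift n i0) * fps_deriv (rshift n j) Q =
          fps_deriv (rshift n j) (xi i0 * Q).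
  by rewrite fps_derivM fps_deriv_var eq_rlshift mul0r add0r.
rewrite xi_divided_diff raddfB /= !deriv_z_exp //.
rewrite [xi_pairing (fun i => fps_deriv j (H i))]xi_pairing_split.
have -> : xi_pairing (kill_row i0 (fun i => fps_deriv j (H i))) =
          xi_pairing (fun i => fps_deriv j (H' i)).
  apply: eq_bigr => i _; congr (_ * in_z _).
  by rewrite /H' /kill_row; case: ifP => //; rewrite raddf0.
rewrite mulrDr !(mulrCA (fps_var _ _)) -/(xi i0) xi_divided_diff -/E -/E'.
by rewrite mulrBr mulrDl addrAC [_ * E - _ + _]addrC mulrCA mulrA.
Qed.

(** Expanding along row [i0], the terms with derivatives of [H i0] are absorbed
    in the derivatives of [Q]; the remaining terms cancel because the
    cofactors are orthogonal to the other rows and have divergence zero. *)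
Lemma row_step :
  in_z (\det (jac_mx H)) * E = in_z (\det (jac_mx H')) * E' +
    \sum_j (xi j * (in_z (C j) * Q) - fps_deriv (rshift n j) (in_z (C j) * Q)).
Proof.
rewrite sumrB.
under [X in _ - X]eq_bigr do rewrite fps_derivM deriv_z_in_z
  deriv_z_divided_diff mulrDr !mulrA -rmorphM.
rewrite !big_split /= -!mulr_suml -!raddf_sum /=.
rewrite (piola charK0) raddf0 mul0r add0r.
have -> : \sum_j in_z (C j) * xi_pairing (fun i => fps_deriv j (H' i)) =
          \sum_(i | i != i0) xi i * in_z (C i).
  under eq_bigr do rewrite mulr_sumr.
  rewrite exchange_big [RHS]big_mkcond /=; apply: eq_bigr => i _.
  under eq_bigr do rewrite mulrCA -rmorphM.
  rewrite -mulr_sumr -raddf_sum /= cofactor_orth.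
  by case: eqVneq => [_|_] /=; rewrite ?raddf0 ?mulr0.
under [\sum_(j < n) xi j * _]eq_bigr do rewrite mulrA.
rewrite -mulr_suml (bigD1 i0) //= [(xi i0 * _ + _) * Q]mulrDl.
rewrite [xi i0 * _]mulrC -mulrA xi_divided_diff det_jac_mx det_kill_row.
rewrite raddfB mulrBl mulrBr /=.
suff cancel (V : zmodType) (a b c d : V) : a - d = b + (a - b + c - (d + c)).
  exact: cancel.
rewrite opprD [- d - c]addrC [a - b + c + _]addrA addrK addrA.
by rewrite [b + _]addrC subrK.
Qed.

Lemma expLambda_kill_row m : order_geq 2 H -> xi_exp m = 0%MM ->
  fcoef (fps_expLambda (in_z (\det (jac_mx H)) * E)) m =
  fcoef (fps_expLambda (in_z (\det (jac_mx H')) * E')) m.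
Proof.
move=> HL m0.
apply: etrans (congr1 (fun w => fcoef (fps_expLambda w) m) row_step) _.
rewrite fps_expLambdaD fps_expLambda_sum fcoefD fcoef_sum.
rewrite big1 ?addr0 // => j _.
rewrite expLambda_xiM //; last first.
  by apply: steepMr (steep_in_z0 _) _; apply: steep_divided_diff.
by rewrite fcoef_varM0 // -xi_expE m0 mnm0E.
Qed.
End OneRow.

Lemma foldr_kill_row H r i :
  foldr kill_row H r i = if i \in r then 0 else H i.
Proof.
elim: r => //= a r IHr; rewrite in_cons /kill_row IHr.
by case: eqVneq.
Qed.

Lemma kill_row_ind (A : Type) (T : ('I_n -> fps n K) -> A) :
  (forall i H, order_geq 2 H -> T H = T (kill_row i H)) ->
  forall H r, order_geq 2 H -> T H = T (foldr kill_row H r).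
Proof.
move=> TE H r HL; elim: r => //= a r IHr; rewrite IHr; apply: TE => i k.
by rewrite foldr_kill_row; case: ifP => _; [case/eqP | apply: HL].
Qed.

(** The part of degree 0 in xi does not change when rows are eliminated, and
    once all of them are, the series is 1. *)
Lemma expLambda_jac_exp H m : order_geq 2 H -> xi_exp m = 0%MM ->
  fcoef (fps_expLambda
    (in_z (\det (jac_mx H)) * fps_exp (xi_pairing H))) m = (m == 0%MM)%:R.
Proof.
move=> HL m0; have step i h (hL : order_geq 2 h) := expLambda_kill_row i hL m0.
rewrite (kill_row_ind step (enum 'I_n) HL) {step}; set h := foldr _ _ _.
have h0 i : h i = 0 by rewrite /h foldr_kill_row mem_enum.
have -> : jac_mx h = 1%:M.
  by apply/matrixP => i j; rewrite jac_mxE h0 raddf0 subr0 mxE eq_sym.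
have -> : xi_pairing h = 0.
  by rewrite /xi_pairing big1 // => i _; rewrite h0 raddf0 mulr0.
have -> : fps_exp (0 : fps (n + n) K) = 1.
  apply: fpsP => k; rewrite fcoef_fps_sumE big_ord_recl big1 => [|l _].
    by rewrite addr0 expr0 mulr1 fcoef_fpsC invr1.
  by rewrite lift0 expr0n mulr0.
rewrite det1 rmorph1 mulr1 fcoef_fps_sumE big_ord_recl big1 => [|k _].
  by rewrite addr0 /= invr1 fcoefCM mul1r fcoef1.
have L1 : fps_Lambda (1 : fps (n + n) K) = 0.
  by rewrite /fps_Lambda big1 // => i _; rewrite -[1]fpsC1 fps_derivC raddf0.
rewrite lift0 iterSr L1 [iter _ _ _](_ : _ = 0) ?mulr0 //.
by elim: (k : nat) => //= l ->; rewrite raddf0.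
Qed.

(** * The inversion formula *)

Section Main.
Variables (H N F G : 'I_n -> fps n K).
Hypothesis (H_order : order_geq 2 H) (N_order : order_geq 2 N).
Hypothesis (F_def : forall i, F i = fps_var K i - H i).
Hypothesis (G_def : forall i, G i = fps_var K i + N i).
Hypothesis (GF : forall i, fps_comp (G i) F = fps_var K i).

(** The variable [z_j] is [G j] evaluated at F, and multiplication by [F i]
    corresponds to multiplication by [z_i]. *)
Lemma intertwined_var_inverse j : intertwined H (fps_var K j) (G j).
Proof.
have := @intertwined_comp _ _ _ H_order F (fps_var K) (G j).
rewrite GF fps_comp_var; apply=> i.
- rewrite F_def fcoefB fcoef_var (order_geqP H_order) ?mdeg0 // subr0.
  by rewrite eq_sym mnm1_eq0.
- by rewrite fcoef_var eq_sym mnm1_eq0.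
- by rewrite F_def; apply: intertwined_var_sub.
Qed.

Lemma intertwined_inverse q : intertwined H q (fps_comp q G).
Proof.
have := @intertwined_comp _ _ _ H_order (fps_var K) G q.
rewrite fps_comp_var; apply=> i.
- by rewrite fcoef_var eq_sym mnm1_eq0.
- rewrite G_def fcoefD fcoef_var (order_geqP N_order) ?mdeg0 // addr0.
  by rewrite eq_sym mnm1_eq0.
- exact: intertwined_var_inverse.
Qed.

Lemma jacobianE : jacobian F = \det (jac_mx H).
Proof. by congr (\det _); apply/matrixP => i j; rewrite !mxE F_def. Qed.

(** Both sides solve d/dxi_j w = N_j w: on the left, conjugation turns [z_j]
    into [z_j + d/dxi_j], and it also turns [z_j] into [G j = z_j + N j]. *)
Lemma expLambda_jacobian :
  fps_expLambda (in_z (jacobian F) * fps_exp (xi_pairing H)) =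
  fps_exp (xi_pairing N).
Proof.
apply: (xi_ode_uniq charK0 (N := N)) => [j|j|m m0].
- have := intertwined_var_inverse j (jacobian F).
  rewrite in_z_var expLambda_zM //; last exact: steep_zE.
  by rewrite G_def raddfD /= in_z_var mulrDl => /addrI.
- exact: deriv_xi_exp.
- by rewrite jacobianE expLambda_jac_exp // fcoef_xi_exp0.
Qed.

Lemma expLambda_inversion q :
  fps_expLambda (in_z q * in_z (jacobian F) * fps_exp (xi_pairing H)) =
  in_z (fps_comp q G) * fps_exp (xi_pairing N).
Proof. by rewrite -mulrA intertwined_inverse expLambda_jacobian. Qed.
End Main.
End Row.

(** * Transfer to the completion *)

Section Completion.
Variables (n : nat) (K : fieldType).
Implicit Types (m : 'X_{1..n + n}) (w : fps (n + n) K).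

Lemma mcoeff_component (u : completion n K) (d : int) m :
  (component u d)@_m = if grade m == d then fcoef (completion_fps u) m else 0.
Proof.
case: eqVneq => [<- //|/eqP ne_d].
apply/eqP; apply: contra_notT ne_d => nz.
by have /graded_partP := component_graded u d; apply.
Qed.

(** In a steep series the exponents of a given grade d satisfy |xi| <= d and
    |z| <= 2 d; there are finitely many of them, and none when d < 0. *)
Lemma steep_grade w m : steep 0 w -> fcoef w m != 0 ->
  [/\ 0 <= grade m & (mdeg m <= 3 * `|grade m|)%N].
Proof.
move=> wS nz.
have le2 : ((mdeg (xi_exp m)).*2 <= mdeg (z_exp m))%N.
  rewrite leqNgt; apply: contraNN nz => lt_m; apply/eqP/wS.
  by rewrite addn0.
have le1 : (mdeg (xi_exp m) <= mdeg (z_exp m))%N.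
  by apply: leq_trans le2; rewrite -addnn leq_addr.
rewrite /grade subzn //; split=> //; rewrite absz_nat mdeg_split.
rewrite -(subnKC le2) -addnn -addnA addKn mulnDr 2![in leqLHS]addnA leq_add //.
  by rewrite !mulSn mul0n addn0 -addnA.
by rewrite leq_pmull.
Qed.

Lemma steep_completion w : steep 0 w -> exists u, completion_fps u = w.
Proof.
move=> wS; pose b (d : int) := (3 * `|d|).+1%N.
pose c (d : int) : {mpoly K[n + n]} :=
  \sum_(k : 'X_{1..(n + n) < b d} | grade k == d) fcoef w k *: 'X_[k].
have cE d m : (c d)@_m = if grade m == d then fcoef w m else 0.
  rewrite raddf_sum /=; under eq_bigr do rewrite mcoeffZ mcoeffX.
  have [lt_m|ge_m] := ltnP (mdeg m) (b d).
    rewrite big_mkcond (bigD1 (BMultinom lt_m)) //= eqxx mulr1 big1 ?addr0 //.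
    by move=> k; rewrite bmeqP => /negPf ->; rewrite mulr0 if_same.
  rewrite big1 => [|k _].
    case: eqVneq => // gm; apply/esym/eqP; apply: contraTT ge_m => nz.
    by case: (steep_grade wS nz) => _; rewrite gm -ltnNge.
  case: eqVneq => [km|_]; last by rewrite mulr0.
  by have := bmdeg k; rewrite km ltnNge ge_m.
have cG d : graded_part d (c d).
  apply/graded_partP => m; rewrite cE.
  by have [//|_] := eqVneq (grade m) d; case/eqP.
have cB : exists d0 : int, forall d, d < d0 -> c d = 0.
  exists 0 => d d_lt0; apply/mpolyP => m; rewrite cE mcoeff0.
  case: eqVneq => // gm; apply/eqP; apply: contraTT d_lt0.
  move=> /(steep_grade wS)[].
  by rewrite gm -leNgt.
by exists (Completion cG cB); apply: fpsP => m; rewrite /fcoef /= cE eqxx.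
Qed.

(** Lambda preserves the grade, so the component of a given grade and the whole
    series have the same iterates of Lambda in the exponents of this grade. *)
Lemma completion_fps_Phi (u : completion n K) : steep 0 (completion_fps u) ->
  completion_fps (Phi u) = fps_expLambda (completion_fps u).
Proof.
move=> uS; apply: fpsP => m; set p := component u (grade m).
have iterE k m' : grade m' = grade m ->
    (iter k (@Lambda n K) p)@_m' =
    fcoef (iter k (@fps_Lambda n K) (completion_fps u)) m'.
  elim: k m' => [|k IHk] m' gm' /=; first by rewrite mcoeff_component gm' eqxx.
  rewrite raddf_sum fcoef_sum /=; apply: eq_bigr => i _.
  by rewrite !mcoeff_mderiv !fcoef_deriv IHk // grade_shift.
(* Both truncations of the exponential series extend to this length by zero.  *)
pose d := maxn (msize p) (mdeg m).+1.
rewrite (fcoef_expLambda (d := d) uS) ?leq_maxr //.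
transitivity (\sum_(k < d) k`!%:R^-1 * (iter k (@Lambda n K) p)@_m); last first.
  by apply: eq_bigr => k _; rewrite iterE.
rewrite -[LHS]/((exp_Lambda p)@_m) /exp_Lambda raddf_sum /=.
under eq_bigr do rewrite mcoeffZ.
rewrite -!(big_mkord xpredT (fun k => k`!%:R^-1 * (iter k (@Lambda n K) p)@_m)).
rewrite [RHS](@big_cat_nat _ _ _ (msize p)) ?leq_maxl //=.
rewrite [X in _ + X]big_nat_cond [X in _ + X]big1 ?addr0 // => k.
by rewrite andbT => /andP[le_pk _]; rewrite Lambda_nilp // mcoeff0 mulr0.
Qed.
End Completion.

Theorem theorem3p2 (K : fieldType) (charK0 : [pchar K] =i pred0)
    (n : nat) (n_ge1 : (1 <= n)%N)
    (H N F G : 'I_n -> fps n K)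
    (H_order : order_geq 2 H)
    (N_order : order_geq 2 N)
    (F_def : forall i, F i = fps_var K i - H i)
    (G_def : forall i, G i = fps_var K i + N i)
    (G_inverse : formal_inverse F G)
    (q : fps n K) :
  exists u v : completion n K,
    [/\ completion_fps u =
          in_z q * in_z (jacobian F) * fps_exp (xi_pairing H),
        completion_fps v =
          in_z (fps_comp q G) * fps_exp (xi_pairing N)
      & Phi u = v].
Proof.
case: G_inverse => _ GF.
have wS : steep 0 (in_z q * in_z (jacobian F) * fps_exp (xi_pairing H)).
  by rewrite -rmorphM; apply: steepMl (steep_in_z0 _) (steep_xi_exp H_order).
have [u uE] := steep_completion wS.
have uS : steep 0 (completion_fps u) by rewrite uE.
exists u, (Phi u); split; [exact uE | | exact (erefl (Phi u))].
rewrite (completion_fps_Phi uS) uE.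
exact (expLambda_inversion charK0 H_order N_order F_def G_def GF q).
Qed.
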